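(* Let $U=\{(x,ax^{q^i}):x\in\mathbb{F}_{q^n}\}$ with $a\in\mathbb{F}_{q^n}^*$ and $\gcd(n,i)=1$, and let $W$ be an $n$-dimensional $\mathbb{F}_q$-subspace of $\mathbb{F}_{q^n}^2$ with $L_U=L_W$. Then $W=\{(y,by^{q^j}):y\in\mathbb{F}_{q^n}\}$ for some $j$ with $\gcd(n,j)=1$ and some $b\in\mathbb{F}_{q^n}^*$ with $N_{q^n|q}(b)=N_{q^n|q}(a)$.
   Context: $L_X=\{\langle u\rangle_{\mathbb{F}_{q^n}}:u\in X\setminus\{0\}\}\subseteq\mathrm{PG}(1,q^n)$. $N_{q^n|q}(x)=x^{1+q+\dots+q^{n-1}}$ is the norm map. *)

(* Defs.v *)
(* F : finFieldType plays the role of F_{q^n}. *)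
From HB Require Import structures.
From mathcomp Require Import all_boot all_order all_algebra all_field.
Set Implicit Arguments. Unset Strict Implicit. Unset Printing Implicit Defensive.
Import GRing.Theory.
Local Open Scope ring_scope.

(* The subfield F_q of F, for q a power of the characteristic: {c | c^q = c}. *)
Definition inFq (F : finFieldType) (q : nat) (c : F) : bool := c ^+ q == c.

Definition Fq_subspace (F : finFieldType) (q : nat) (X : {set F * F}) : Prop :=
  [/\ (0, 0) \in X,
      forall u v, u \in X -> v \in X -> (u.1 + v.1, u.2 + v.2) \in X
    & forall c u, inFq q c -> u \in X -> (c * u.1, c * u.2) \in X].

(* The F_{q^n}-span <u> of a vector u of F^2 (a point of PG(1,q^n) when u != 0). *)
Definition Fspan (F : finFieldType) (u : F * F) : {set F * F} :=
  [set (l * u.1, l * u.2) | l : F].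

Definition LX (F : finFieldType) (X : {set F * F}) : {set {set F * F}} :=
  [set Fspan u | u in X :\ ((0 : F), (0 : F))].

Definition normF (F : finFieldType) (q n : nat) (x : F) : F :=
  x ^+ (\sum_(k < n) q ^ k)%N.

Definition graphU (F : finFieldType) (q i : nat) (a : F) : {set F * F} :=
  [set (x, a * x ^+ (q ^ i)) | x : F].

(* Main.v *)
(* W is the graph of an F_q-linear map g(x) = sum_k b_k x^(q^k), and L_U = L_W
   means that f(x)/x, with f(x) = a x^(q^i), and g(x)/x take the same values
   on nonzero x.  Each value is taken -1 mod p times, so the power sums of
   f(x)/x and g(x)/x over nonzero x agree.  For a nonempty set S of residues
   mod n take the exponent sum_(s in S) q^s: a string of digits 0 and 1 has least
   digit sum in its class mod q^n - 1, so the power sum of g(x)/x is minus the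
   permanent on S of the matrix b_(t-s)^(q^s).  For f it vanishes if S is
   proper.  In the digraph s -> t iff b_(t-s) <> 0, a minimal nonempty S in
   which every vertex has an out-neighbour is a chordless cycle, whose permanent
   is a single nonzero product; hence S is everything, the out-degree is 1, and
   g is a monomial. *)
Require Import Defs.
From HB Require Import structures.
From mathcomp Require Import all_boot all_order all_fingroup all_algebra all_solvable all_field.
From mathcomp Require Import zify.
Set Implicit Arguments. Unset Strict Implicit. Unset Printing Implicit Defensive.
Import GRing.Theory.
Local Open Scope ring_scope.

(** * Base-q digit strings modulo q^N - 1 *)

Section Digits.
Local Open Scope nat_scope.
Variable q : nat.
Hypothesis q_gt1 : 1 < q.

Definition digit_value n (m : 'I_n -> nat) := \sum_t m t * q ^ t.

Lemma digit_value_recl n (m : 'I_n.+1 -> nat) :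
  digit_value m = m ord0 + q * digit_value (fun t => m (lift ord0 t)).
Proof.
rewrite /digit_value big_ord_recl muln1 big_distrr /=; congr (_ + _).
by apply: eq_bigr => t _; rewrite expnS mulnCA.
Qed.

Lemma digit_value_lt n (m : 'I_n -> nat) :
  (forall t, m t < q) -> digit_value m < q ^ n.
Proof.
elim: n m => [|n IHn] m m_lt; first by rewrite /digit_value big_ord0.
rewrite digit_value_recl expnS.
have := IHn _ (fun t => m_lt (lift ord0 t)).
rewrite -(leq_pmul2l (ltnW q_gt1)) mulnS; apply: leq_trans.
by rewrite ltn_add2r.
Qed.

Lemma digit_value_inj n (m m' : 'I_n -> nat) :
    (forall t, m t < q) -> (forall t, m' t < q) ->
  digit_value m = digit_value m' -> m =1 m'.
Proof.
elim: n m m' => [|n IHn] m m' m_lt m'_lt; first by move=> _ [].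
rewrite !digit_value_recl => eq_mm'.
have eq0 : m ord0 = m' ord0.
  move: (congr1 (modn^~ q) eq_mm').
  by rewrite -!(addnC (q * _)) -!(mulnC _ q) !modnMDl !modn_small.
have /IHn eqS : digit_value (fun t => m (lift ord0 t)) =
                digit_value (fun t => m' (lift ord0 t)).
  by move: eq_mm'; rewrite eq0 => /addnI/eqP; rewrite eqn_pmul2l ?(ltnW q_gt1) // => /eqP.
by move=> t; case: (unliftP ord0 t) => [u|] -> //; apply: eqS.
Qed.

Variable n : nat.
Local Notation N := n.+1.

(** Representatives are taken in 1..z because a nonzero string of digits below q can have the value
    q^N - 1 itself. *)
Lemma modn_pos_inj z x y :
  0 < x <= z -> 0 < y <= z -> x = y %[mod z] -> x = y.
Proof.
rewrite (leq_eqVlt x) (leq_eqVlt y) => /andP[x0 /orP[/eqP->|x_lt]] /andP[y0 /orP[/eqP->|y_lt]] //.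
- by rewrite modnn modn_small // => /esym y_eq0; rewrite y_eq0 in y0.
- by rewrite modnn modn_small // => x_eq0; rewrite x_eq0 in x0.
- by rewrite !modn_small.
Qed.

Lemma predn_exp_gt0 : 0 < (q ^ N).-1.
Proof. by have := ltn_expl N q_gt1; lia. Qed.

Lemma expn_mod_predn k : q ^ (k %% N) = q ^ k %[mod (q ^ N).-1].
Proof.
have qN1 : q ^ N = 1 %[mod (q ^ N).-1].
  have: 0 < q ^ N by rewrite expn_gt0 ltnW.
  by case: (q ^ N) => //= z _; rewrite -addn1 modnDl.
rewrite [in RHS](divn_eq k N) expnD (mulnC (k %/ N)) expnM.
by rewrite -[in RHS]modnMml -[in RHS]modnXm qN1 modnXm exp1n modnMml mul1n.
Qed.

(** Trades q units at t for one unit at the next position, cyclically because q^N = 1 modulo q^N -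
    1; the truncated subtraction is exact only if [q <= m t]. *)
Definition carry (m : 'I_N -> nat) (t u : 'I_N) : nat :=
  m u - q * (u == t) + (u == ordS t).

Lemma sum_indicator (t : 'I_N) (f : 'I_N -> nat) :
  \sum_u (u == t) * f u = f t.
Proof.
rewrite (bigD1 t) //= eqxx mul1n big1 ?addn0 // => u /negPf->; exact: mul0n.
Qed.

(** The weight [f] covers both the digit sum and the digit value. *)
Lemma sum_carry (m : 'I_N -> nat) t (f : 'I_N -> nat) : q <= m t ->
  \sum_u carry m t u * f u + q * f t = \sum_u m u * f u + f (ordS t).
Proof.
move=> qm; rewrite -(sum_indicator t f) -(sum_indicator (ordS t) f).
rewrite big_distrr -!big_split /=; apply: eq_bigr => u _.
by rewrite /carry; case: eqP => [->|_]; case: eqP => _ /=; nia.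
Qed.

Lemma digit_value_carry (m : 'I_N -> nat) t : q <= m t ->
  digit_value (carry m t) = digit_value m %[mod (q ^ N).-1].
Proof.
move=> qm; apply/eqP; rewrite -(eqn_modDr (q * q ^ t)).
rewrite (sum_carry (fun u : 'I_N => q ^ u)) //= -expnS.
by rewrite eqn_modDl expn_mod_predn.
Qed.

(* Carrying lowers the digit sum by q - 1 > 0, so a 0/1 digit string has
   minimal digit sum in its class modulo q^N - 1, and only itself attains it. *)
Lemma digit_sum_min (m : 'I_N -> nat) (S : {set 'I_N}) :
    S != set0 -> 0 < \sum_t m t ->
    digit_value m = \sum_(t in S) q ^ t %[mod (q ^ N).-1] ->
    #|S| <= \sum_t m t /\ (\sum_t m t <= #|S| -> forall t, m t = (t \in S)).
Proof.
move=> S_neq0; have [k] := ubnP (\sum_t m t).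
elim: k m => // k IHk m m_lt m_gt0 eq_mS.
have [/existsP[t qm]|] := boolP [exists t, q <= m t].
  have sumE : \sum_u carry m t u + q = \sum_u m u + 1.
    by have := sum_carry (fun=> 1) qm; rewrite -!big_distrl /= !muln1.
  have mt_le : m t <= \sum_u m u by rewrite (bigD1 t) //= leq_addr.
  (* The digit sum drops strictly, so the equality case of the conclusion is vacuous here. *)
  have [| | |] := IHk (carry m t); rewrite ?digit_value_carry //; lia.
rewrite negb_exists => /forallP m_small.
have {}m_small t : m t < q by rewrite ltnNge m_small.
pose chi t : nat := t \in S.
have chi_lt t : chi t < q by rewrite /chi; case: (_ \in _) => //; apply: ltnW.
have chiE : \sum_(t in S) q ^ t = digit_value chi.
  rewrite /digit_value big_mkcond /=; apply: eq_bigr => t _.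
  by rewrite /chi; case: ifP; rewrite ?mul1n ?mul0n.
have pos f : 0 < \sum_(t : 'I_N) f t -> 0 < digit_value f.
  rewrite !lt0n; apply: contra; rewrite /digit_value !sum_nat_eq0.
  move=> /forallP f0; apply/forallP => t; have := f0 t.
  by rewrite muln_eq0 expn_eq0; case: (q) q_gt1 => //= _ _; rewrite orbF.
have cardS : \sum_t chi t = #|S|.
  by rewrite -sum1_card [RHS]big_mkcond /=; apply: eq_bigr => t _; rewrite /chi; case: ifP.
have eqv_mod : digit_value m = digit_value chi %[mod (q ^ N).-1] by rewrite eq_mS chiE.
have eqv : digit_value m = digit_value chi.
  apply: modn_pos_inj (eqv_mod); rewrite ?pos ?cardS ?card_gt0 //=.
    by rewrite -ltnS prednK ?digit_value_lt // expn_gt0 ltnW.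
  by rewrite -ltnS prednK ?digit_value_lt // expn_gt0 ltnW.
have eqm := digit_value_inj m_small chi_lt eqv.
split; last by move=> _ t; apply: eqm.
by rewrite -cardS; apply: eq_leq; apply: eq_bigr => t _; rewrite eqm.
Qed.

(** The sizes of the fibres of [psi] on S form a digit string with digit sum #|S|, which is minimal
    in its class, so the string is the indicator of S. *)
Lemma sum_powers_stable (S : {set 'I_N}) (psi : 'I_N -> 'I_N) :
    S != set0 ->
    \sum_(s in S) q ^ psi s = \sum_(s in S) q ^ s %[mod (q ^ N).-1] ->
  {in S, forall s, psi s \in S}.
Proof.
move=> S_neq0 eqS; pose m t := \sum_(s in S) (psi s == t : nat).
have sum_m (f : 'I_N -> nat) : \sum_t m t * f t = \sum_(s in S) f (psi s).
  under eq_bigr do rewrite big_distrl /=.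
  rewrite exchange_big /=; apply: eq_bigr => s _.
  by under eq_bigr do rewrite eq_sym; rewrite sum_indicator.
have sum1 : \sum_t m t = #|S|.
  rewrite -sum1_card -(sum_m (fun=> 1)); apply: eq_bigr => t _; exact/esym/muln1.
have [||_ mE] := @digit_sum_min m S S_neq0.
- by rewrite sum1 card_gt0.
- by rewrite /digit_value sum_m.
have {}mE t : m t = (t \in S) by apply: mE; rewrite sum1.
move=> s Ss; rewrite -[_ \in S]lt0b -mE lt0n.
by rewrite /m (bigD1 s) //= eqxx.
Qed.
End Digits.

(** * Power sums of g(x)/x for additive g *)

Section Ratios.
Variable F : finFieldType.

Lemma additive_set_card0 (V : {set F}) (v : F) :
    0 \in V -> {in V &, forall x y, x + y \in V} -> v \in V -> v != 0 ->
  #|V|%:R = 0 :> F.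
Proof.
move=> V0 VD Vv v_neq0.
have gV : group_set V by apply/group_setP; split.
have := expg_cardG (Vv : v \in Group gV); rewrite FinRing.zmodXgE FinRing.zmod1gE /= => vV0.
have /eqP : v * #|V|%:R = 0 by rewrite mulr_natr.
by rewrite mulf_eq0 (negPf v_neq0) => /eqP.
Qed.

(** The slopes of the points of L_X when X is the graph of [g]. *)
Definition ratios (g : F -> F) : {set F} := [set g x / x | x in predC1 0].

(* Together with 0, each fibre of x |-> g x / x is a nonzero additive group,
   so its size vanishes in F. *)
Lemma sum_ratios (g : F -> F) (h : F -> F) : {morph g : x y / x + y} ->
  \sum_(x | x != 0) h (g x / x) = - \sum_(m in ratios g) h m.
Proof.
move=> gD; rewrite (partition_big (fun x => g x / x) (mem (ratios g))) /=; last first.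
  by move=> x x_neq0; apply: imset_f.
rewrite -sumrN; apply: eq_bigr => m /imsetP[v v_neq0 mE].
rewrite (eq_bigr (fun=> h m)) => [|x /andP[_ /eqP->] //].
pose V := [set x | g x == m * x].
have g0 : g 0 = 0 by apply: (addrI (g 0)); rewrite -gD !addr0.
have V0 : 0 \in V by rewrite inE g0 mulr0.
have cardV : #|V|%:R = 0 :> F.
  apply: (@additive_set_card0 V v) => //; last by rewrite inE mE divfK.
  by move=> x y; rewrite !inE gD mulrDr => /eqP-> /eqP->.
have -> : \sum_(x | (x != 0) && (g x / x == m)) h m = \sum_(x in V :\ 0) h m.
  apply: eq_bigl => x; rewrite !inE; have [//|x_neq0 /=] := eqVneq x 0.
  by rewrite -(inj_eq (mulIf x_neq0)) divfK.
rewrite sumr_const -mulr_natr; apply/eqP; rewrite -addr_eq0 -[X in _ + X]mulr1 -mulrDr natr1.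
by move: cardV; rewrite (cardsD1 0 V) V0 add1n => ->; rewrite mulr0.
Qed.

End Ratios.

(** By Euler's theorem i is invertible modulo n.+1, so repeated translation by i reaches every
    residue. *)
Lemma translation_stable_setT n i (S : {set 'I_n.+1}) :
    coprime n.+1 i -> S != set0 ->
    {in S, forall s, s + inord (i %% n.+1) \in S} ->
  S = setT.
Proof.
move=> co_ni /set0Pn[s Ss] Si; apply/setP => t; rewrite inE.
have Sm m : s + inord (i %% n.+1) *+ m \in S.
  by elim: m => [|m IHm]; rewrite ?addr0 // mulrSr addrA Si.
have tot_gt0 : (0 < totient n.+1)%N by rewrite totient_gt0.
have inv_i : (i * i ^ (totient n.+1).-1 = 1 %[mod n.+1])%N.
  by rewrite -expnS prednK // Euler_exp_totient // coprime_sym.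
suff: inord (i %% n.+1) *+ (i ^ (totient n.+1).-1 * (t - s)%R) = t - s.
  by move=> tE; rewrite -(subrK s t) addrC -tE Sm.
move: (t - s) => w; apply/val_inj; rewrite Zp_mulrn /= inordK ?ltn_mod // modnMml mulnA.
by rewrite -modnMml inv_i modnMml mul1n modn_small.
Qed.

(** * Linearized polynomials, with exponents indexed by Z/N *)

Section LinearizedPolynomials.
Variables (F : finFieldType) (q n : nat).
Local Notation N := n.+1.
Hypothesis q_pchar : [pchar F].-nat q.
Hypothesis q_gt1 : (1 < q)%N.
Hypothesis cardF : #|F| = (q ^ N)%N.

Lemma frobeniusD k (x y : F) : (x + y) ^+ (q ^ k) = x ^+ (q ^ k) + y ^+ (q ^ k).
Proof. by rewrite exprDn_pchar // pnatX q_pchar. Qed.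

Lemma frobenius_sum k I (r : seq I) (P : pred I) (f : I -> F) :
  (\sum_(i <- r | P i) f i) ^+ (q ^ k) = \sum_(i <- r | P i) f i ^+ (q ^ k).
Proof.
apply: (big_morph (fun x => x ^+ (q ^ k))); first exact: frobeniusD.
by rewrite expr0n expn_eq0 -leqn0 leqNgt (ltnW q_gt1).
Qed.

Lemma natf_card0 : #|F|%:R = 0 :> F.
Proof.
rewrite cardF natrX; apply/eqP; rewrite expf_eq0 /=.
have [p p_pr p_dv] := pdivP q_gt1.
have p_char : p \in [pchar F] by rewrite (pnatPpi q_pchar) // mem_primes p_pr ltnW.
by rewrite -(dvdn_pcharf p_char).
Qed.

Lemma expf_predn_card (x : F) : x != 0 -> x ^+ (q ^ N).-1 = 1.
Proof.
move=> x_neq0; apply: (mulfI x_neq0); rewrite -exprS prednK ?expn_gt0 ?(ltnW q_gt1) //.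
by rewrite -cardF expf_card mulr1.
Qed.

Lemma expf_mod_predn A B (x : F) : x != 0 ->
  (A = B %[mod (q ^ N).-1])%N -> x ^+ A = x ^+ B.
Proof.
move=> /expf_predn_card x1 eqAB.
by rewrite -(expr_mod A x1) eqAB expr_mod.
Qed.

Lemma frobenius_mod k (x : F) : x ^+ (q ^ (k %% N)) = x ^+ (q ^ k).
Proof.
have [->|x_neq0] := eqVneq x 0; last by apply: expf_mod_predn => //; exact: expn_mod_predn.
by rewrite !expr0n !expn_eq0 -leqn0 leqNgt (ltnW q_gt1).
Qed.

(** Orthogonality of characters: scaling x by a primitive root z multiplies the sum by z^A / z^B,
    which is not 1 off the diagonal; on the diagonal q^N - 1 = -1 in F. *)
Lemma sum_pow_ratio A B :
  \sum_(x : F | x != 0) x ^+ A / x ^+ B = - (A == B %[mod (q ^ N).-1])%:R.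
Proof.
have [eqAB|neqAB] := eqVneq (A %% (q ^ N).-1)%N (B %% (q ^ N).-1)%N.
  rewrite (eq_bigr (fun=> 1)) => [|x x_neq0]; last first.
    by rewrite (expf_mod_predn x_neq0 eqAB) divff // expf_neq0.
  rewrite sumr_const cardC1 cardF; apply/eqP.
  by rewrite -addr_eq0 -mulrSr prednK ?expn_gt0 ?(ltnW q_gt1) // -cardF natf_card0.
have /hasP[z z_in z_prim] : has (q ^ N).-1.-primitive_root (enum (predC1 (0 : F))).
  apply: has_prim_root; rewrite ?enum_uniq ?predn_exp_gt0 //.
    apply/allP => x; rewrite mem_enum inE => x_neq0.
    by rewrite unity_rootE expf_predn_card.
  by rewrite -cardE cardC1 cardF.
have z_neq0 : z != 0 by move: z_in; rewrite mem_enum inE.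
set T := \sum_(x | _) _; pose c := z ^+ A / z ^+ B.
have cT : c * T = T.
  rewrite [RHS](reindex_onto ( *%R z) ( *%R z^-1)) /= => [|x _]; last by rewrite mulVKf.
  rewrite /T big_distrr /=; apply: eq_big => [x|x _].
    by rewrite mulf_eq0 negb_or z_neq0 mulKf // eqxx andbT.
  by rewrite !exprMn invfM mulrACA.
have c_neq1 : c != 1.
  by rewrite -subr_eq0 /c -(divff (expf_neq0 B z_neq0)) -mulrBl mulf_eq0 subr_eq0
     invr_eq0 expf_eq0 (negPf z_neq0) andbF orbF (eq_prim_root_expr z_prim).
rewrite oppr0; apply/eqP; rewrite -(mulrI_eq0 _ (mulfI (_ : c - 1 != 0))) ?subr_eq0 //.
by rewrite mulrBl cT mul1r subrr.
Qed.

Definition qlinpoly (b : 'I_N -> F) (x : F) := \sum_k b k * x ^+ (q ^ k).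

Definition Fq_linear (g : F -> F) :=
  (forall x y, g (x + y) = g x + g y) /\
  (forall c x, inFq q c -> g (c * x) = c * g x).

Lemma inFq_frobenius (c : F) k : inFq q c -> c ^+ (q ^ k) = c.
Proof.
move=> /eqP cq; elim: k => [|k IHk]; first by rewrite expr1.
by rewrite expnS exprM cq.
Qed.

Lemma qlinpoly_linear b : Fq_linear (qlinpoly b).
Proof.
split=> [x y|c x Fq_c]; rewrite /qlinpoly.
  by rewrite -big_split; apply: eq_bigr => k _; rewrite frobeniusD mulrDr.
rewrite mulr_sumr; apply: eq_bigr => k _.
by rewrite exprMn (inFq_frobenius _ Fq_c) mulrCA.
Qed.

Lemma qlinpoly_monomial (c : F) (i : nat) :
  (fun x => c * x ^+ (q ^ i)) =1
  qlinpoly (fun k => if k == inord (i %% N) then c else 0).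
Proof.
move=> x; rewrite /qlinpoly (bigD1 (inord (i %% N))) //= eqxx big1 => [|k /negPf->].
  by rewrite inordK ?ltn_mod // frobenius_mod addr0.
by rewrite mul0r.
Qed.

Lemma qlinpoly_frobenius b :
  (fun x => qlinpoly b x ^+ q) =1 qlinpoly (fun k => b (ord_pred k) ^+ q).
Proof.
move=> x; rewrite /qlinpoly (frobenius_sum 1).
rewrite [RHS](reindex_inj (@ordS_inj N)); apply: eq_bigr => k _.
by rewrite ordSK expn1 exprMn -exprM -expnSr /= frobenius_mod.
Qed.

Lemma qlinpoly_lin_comb (c d : F) b b' :
  (fun x => c * qlinpoly b x + d * qlinpoly b' x) =1
  qlinpoly (fun k => c * b k + d * b' k).
Proof.
move=> x; rewrite /qlinpoly !mulr_sumr -big_split; apply: eq_bigr => k _ /=.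
by rewrite mulrDl !mulrA.
Qed.

(* Newton interpolation: L is an annihilator of a subspace on which g is already
   interpolated; adjoining v adds F_q v to that subspace and replaces L
   by L^q - L(v)^(q-1) L. *)
Lemma Fq_linear_qlinpoly (g : F -> F) : Fq_linear g -> exists b, g =1 qlinpoly b.
Proof.
move=> [gD gZ].
(* [l] stands for L; the induction is on the number of points where L does not vanish. *)
suff interp m : forall l b,
    (forall x, qlinpoly l x = 0 -> g x = qlinpoly b x) ->
    (#|[set x | qlinpoly l x != 0%R]| <= m)%N -> exists b, g =1 qlinpoly b.
  pose l0 (k : 'I_N) : F := if k == inord (0 %% N) then 1 else 0.
  have id_mono : qlinpoly l0 =1 id.
    by move=> x; rewrite -(qlinpoly_monomial 1 0) mul1r expr1.
  apply: (interp #|F| l0 (fun=> 0)) (max_card _) => x.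
  rewrite id_mono => ->; rewrite /qlinpoly big1 => [|k _]; last by rewrite mul0r.
  by apply: (addrI (g 0)); rewrite -gD !addr0.
elim: m => [|m IHm] l b gb lt_m.
  exists b => x; apply: gb; apply: contraTeq lt_m => lx.
  by rewrite -ltnNge card_gt0; apply/set0Pn; exists x; rewrite inE.
have [/existsP[v lv]|/existsPn l0] := boolP [exists v, qlinpoly l v != 0]; last first.
  by exists b => x; apply: gb; apply/eqP; have := l0 x; rewrite negbK.
have [lD lZ] := qlinpoly_linear l; have [bD bZ] := qlinpoly_linear b.
(* Adding r L to the interpolant corrects its value at v and changes nothing on the kernel of L. *)
pose r := (g v - qlinpoly b v) / qlinpoly l v.
pose l' k := 1 * l (ord_pred k) ^+ q + - (qlinpoly l v ^+ q.-1) * l k.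
have l'E x : qlinpoly l' x = qlinpoly l x ^+ q - qlinpoly l v ^+ q.-1 * qlinpoly l x.
  by rewrite -qlinpoly_lin_comb -qlinpoly_frobenius mul1r mulNr.
have q_gt0 := ltnW q_gt1.
apply: (IHm l' (fun k => 1 * b k + r * l k)).
  move=> x; rewrite l'E -qlinpoly_lin_comb mul1r => l'x0.
  (* A zero x of the new L has L(x) / L(v) in F_q, so x - c v lies in the kernel of the old L. *)
  pose c := qlinpoly l x / qlinpoly l v.
  have Fq_c : inFq q c.
    rewrite /inFq expr_div_n -subr_eq0.
    have -> : qlinpoly l x ^+ q = qlinpoly l v ^+ q.-1 * qlinpoly l x.
      by apply/eqP; rewrite -subr_eq0 l'x0.
    rewrite -{2}(prednK q_gt0) exprSr invfM mulrACA divff ?expf_neq0 //.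
    by rewrite mul1r subrr.
  have xE : x = (x - c * v) + c * v by rewrite subrK.
  have l0 : qlinpoly l (x - c * v) = 0.
    apply: (addIr (qlinpoly l (c * v))); rewrite -lD subrK add0r lZ //.
    by rewrite /c divfK.
  move: (x - c * v) l0 xE => u l0 ->.
  rewrite gD gb // bD lD l0 add0r gZ // bZ // lZ // -addrA; congr (_ + _).
  rewrite mulrCA -mulrDr; congr (_ * _).
  by rewrite /r divfK // addrC subrK.
rewrite -ltnS; apply: leq_trans lt_m; apply: proper_card; apply/properP; split.
  apply/subsetP => x; rewrite !inE l'E; apply: contra => /eqP->.
  by rewrite mulr0 subr0 expr0n -leqn0 leqNgt q_gt0.
by exists v; rewrite !inE // l'E -exprSr prednK // subrr eqxx.
Qed.

(** * Power sums as permanents *)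

(** The coefficients are row s of the Dickson matrix of [b]. *)
Lemma qlinpoly_frobenius_iter (b : 'I_N -> F) x (s : 'I_N) :
  qlinpoly b x ^+ (q ^ s) = \sum_t b (t - s) ^+ (q ^ s) * x ^+ (q ^ t).
Proof.
rewrite /qlinpoly frobenius_sum (reindex_inj (addIr (- s))).
apply: eq_bigr => t _; rewrite exprMn -exprM -expnD; congr (_ * _).
rewrite -[LHS]frobenius_mod; congr (x ^+ (q ^ _)%N).
by rewrite -[in RHS](subrK s t).
Qed.

Definition qsum (S : {set 'I_N}) : nat := (\sum_(s in S) q ^ s)%N.

(** Expanding the product of the rows in S gives one term per choice of columns psi, and
    [sum_pow_ratio] keeps those of the right weight. Setting psi to [ord0] off S counts each choice
    once. *)
Lemma qlinpoly_power_sum (b : 'I_N -> F) (S : {set 'I_N}) :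
  \sum_(x : F | x != 0) (qlinpoly b x / x) ^+ qsum S =
  - \sum_(psi in pffun_on ord0 (mem S) predT |
          (\sum_(s in S) q ^ (psi s : nat))%N == qsum S %[mod (q ^ N).-1])
      \prod_(s in S) b (psi s - s) ^+ (q ^ s).
Proof.
pose wt (psi : {ffun 'I_N -> 'I_N}) : nat := (\sum_(s in S) q ^ (psi s : nat))%N.
pose c (psi : {ffun 'I_N -> 'I_N}) := \prod_(s in S) b (psi s - s) ^+ (q ^ s).
transitivity (\sum_(x : F | x != 0)
    \sum_(psi in pffun_on ord0 (mem S) predT) c psi * (x ^+ wt psi / x ^+ qsum S)).
  apply: eq_bigr => x _; rewrite expr_div_n {1}/qsum -prodrXr.
  under eq_bigr do rewrite qlinpoly_frobenius_iter.
  rewrite (big_distr_big ord0) mulr_suml; apply: eq_bigr => psi _.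
  by rewrite big_split /= prodrXr mulrA.
rewrite exchange_big /= -sumrN big_mkcondr /=; apply: eq_bigr => psi _.
rewrite -mulr_sumr sum_pow_ratio /wt.
by case: ifP => _; rewrite ?oppr0 ?mulr0 ?mulrN1.
Qed.

(** Every surviving psi maps S to itself, so its product contains an entry of row s in a column of
    S, which is 0. *)
Lemma power_sum_eq0 (b : 'I_N -> F) (S : {set 'I_N}) s :
    s \in S -> {in S, forall t, b (t - s) = 0} ->
  \sum_(x : F | x != 0) (qlinpoly b x / x) ^+ qsum S = 0.
Proof.
move=> Ss bs0; rewrite qlinpoly_power_sum big1 ?oppr0 // => psi /andP[_ /eqP psi_mod].
have S_neq0 : S != set0 by apply/set0Pn; exists s.
have psiS := sum_powers_stable q_gt1 S_neq0 psi_mod.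
by rewrite (bigD1 s) //= bs0 ?psiS // expr0n expn_eq0 -leqn0 leqNgt (ltnW q_gt1) mul0r.
Qed.

(** A surviving psi with nonzero product must follow [nxt] on S, so one term remains; [nxt] permutes
    S, which gives it the right weight. *)
Lemma power_sum_neq0 (b : 'I_N -> F) (S : {set 'I_N}) (nxt : 'I_N -> 'I_N) :
    S != set0 -> nxt @: S = S -> {in S, forall s, b (nxt s - s) != 0} ->
    {in S &, forall s t, b (t - s) != 0 -> t = nxt s} ->
  \sum_(x : F | x != 0) (qlinpoly b x / x) ^+ qsum S != 0.
Proof.
move=> S_neq0 nxtS b_neq0 nxt_uniq; rewrite qlinpoly_power_sum oppr_eq0.
have nxt_inj : {in S &, injective nxt} by apply/imset_injP; rewrite nxtS.
pose psi0 := [ffun s => if s \in S then nxt s else ord0].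
rewrite (bigD1 psi0) /=; last first.
  apply/andP; split.
    apply/pffun_onP; split=> //; apply/subsetP => s; rewrite !inE ffunE.
    by case: ifP; rewrite ?eqxx.
  apply/eqP; congr (_ %% _)%N; rewrite /qsum -[in RHS]nxtS big_imset //=.
  by apply: eq_bigr => s Ss; rewrite ffunE Ss.
rewrite [X in _ + X]big1 ?addr0 => [|psi /andP[/andP[/pffun_onP[psi_supp _] /eqP psi_mod] neq_psi]].
  by apply/prodf_neq0 => s Ss; rewrite expf_neq0 // ffunE Ss b_neq0.
have psiS := sum_powers_stable q_gt1 S_neq0 psi_mod.
apply/eqP; apply: contraNT neq_psi => /prodf_neq0 psi_neq0.
apply/eqP/ffunP => s; rewrite ffunE; case: ifP => Ss; last first.
  apply/eqP; apply: contraFT Ss => psi_s; exact: (subsetP psi_supp).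
apply: nxt_uniq => //; first exact: psiS.
by have := psi_neq0 s Ss; rewrite expf_eq0 negb_and expn_gt0 ltnW.
Qed.

(** * Linearized polynomials with the ratios of a monomial *)

Lemma monomial_additive (a : F) i :
  {morph (fun x => a * x ^+ (q ^ i)) : x y / x + y}.
Proof. by move=> x y; rewrite frobeniusD mulrDr. Qed.

(* [closed S] below says that every vertex of S has an out-neighbour in S, in
   the digraph with an arc s -> t whenever b (t - s) != 0; minimality of S makes
   every choice of out-neighbours a permutation of S. *)
Lemma same_ratios_monomial (a : F) i (b : 'I_N -> F) :
    coprime N i -> (exists k, b k != 0) ->
    ratios (fun x => a * x ^+ (q ^ i)) = ratios (qlinpoly b) ->
  exists k : 'I_N, [/\ coprime N k, b k != 0 & forall k', k' != k -> b k' = 0].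
Proof.
move=> co_Ni [k0 bk0] eq_ratios.
have same_sums d : \sum_(x : F | x != 0) (a * x ^+ (q ^ i) / x) ^+ d =
                   \sum_(x : F | x != 0) (qlinpoly b x / x) ^+ d.
  rewrite (sum_ratios (fun y => y ^+ d) (monomial_additive a i)) eq_ratios.
  by rewrite -sum_ratios //; case: (qlinpoly_linear b).
pose closed (S : {set 'I_N}) := (S != set0) &&
  [forall s in S, [exists t in S, b (t - s) != 0]].
have closedP f (S : {set 'I_N}) s0 : s0 \in S ->
    {in S, forall s, f s \in S /\ b (f s - s) != 0} -> closed S.
  move=> Ss0 fS; apply/andP; split; first by apply/set0Pn; exists s0.
  by apply/forall_inP => s /fS[fs bs]; apply/exists_inP; exists (f s).
have /ex_minset[S /minsetP[/andP[S_neq0 /forall_inP S_out] S_min]] : exists S, closed S.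
  exists setT; apply: (closedP (fun s => s + k0) _ 0) => // s _.
  by rewrite in_setT addrAC subrr add0r.
(* The image f(S) is again [closed] and lies in S, so minimality makes f onto. *)
have onto f : {in S, forall s, f s \in S /\ b (f s - s) != 0} -> f @: S = S.
  move=> fS; have [s0 Ss0] := set0Pn _ S_neq0.
  apply: S_min; last by apply/subsetP => _ /imsetP[s /fS[fs _] ->].
  apply: (closedP f _ (f s0)); first exact: imset_f.
  by move=> _ /imsetP[s /fS[fs _] ->]; have [_ bs] := fS _ fs; rewrite imset_f.
pose nxt (s : 'I_N) : 'I_N := odflt s [pick t in S | b (t - s) != 0].
have nxtP : {in S, forall s, nxt s \in S /\ b (nxt s - s) != 0}.
  move=> s /S_out/exists_inP[t St bt]; rewrite /nxt; case: pickP => [u /andP[]//|].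
  by move=> /(_ t); rewrite St bt.
(* Redirecting s alone to t still permutes S, so t cannot also be the image of another vertex. *)
have nxt_uniq : {in S &, forall s t, b (t - s) != 0 -> t = nxt s}.
  move=> s t Ss St bt; pose f u := if u == s then t else nxt u.
  have fS : f @: S = S.
    by apply: onto => u Su; rewrite /f; case: eqP => [->//|_]; apply: nxtP.
  have f_inj : {in S &, injective f} by apply/imset_injP; rewrite fS.
  move: (St); rewrite -{1}(onto nxt nxtP) => /imsetP[u Su tE].
  have [<-//|neq_us] := eqVneq u s.
  by case/eqP: neq_us; apply: f_inj => //; rewrite /f eqxx; case: eqP.
have ST : S = setT.
  have [//|S_neqT] := eqVneq S setT.
  have sum_neq0 : \sum_(x : F | x != 0) (qlinpoly b x / x) ^+ qsum S != 0.
    apply: (power_sum_neq0 S_neq0 (onto nxt nxtP)) => //.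
    by move=> s /nxtP[].
  (* A proper S is not stable under translation by i; where s + i leaves S, row s for the monomial
     vanishes on S. *)
  have [/forall_inP Si|] := boolP [forall s in S, s + inord (i %% N) \in S].
    exact: translation_stable_setT co_Ni S_neq0 Si.
  case/forall_inPn => s Ss Nsi; case/eqP: sum_neq0; rewrite -same_sums.
  under eq_bigr do rewrite qlinpoly_monomial.
  apply: (power_sum_eq0 Ss) => t St.
  by case: eqP => // ts; rewrite -ts addrC subrK St in Nsi.
have {nxt_uniq} b_uniq k : b k != 0 -> k = nxt 0.
  by move=> bk; apply: nxt_uniq; rewrite ?ST ?in_setT ?subr0.
have bn : b (nxt 0) != 0 by have [] := nxtP 0; rewrite ?ST ?in_setT ?subr0.
exists (nxt 0); split=> //; last first.
  by move=> k'; apply: contraNeq => /b_uniq->.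
(* The multiples of gcd(N, k) are [closed], hence everything by minimality, and so contain 1. *)
pose k := nxt 0; pose D := [set s : 'I_N | (gcdn N k %| s)%N].
have DT : D = setT.
  rewrite -ST; apply: S_min; last by rewrite ST subsetT.
  apply: (closedP (fun s => s + k) _ 0); first by rewrite inE dvdn0.
  move=> s; rewrite !inE => ds; split; last by rewrite addrAC subrr add0r.
  by rewrite /= /dvdn modn_dvdm ?dvdn_gcdl // -/(dvdn _ _) dvdn_add // dvdn_gcdr.
(* For N = 1 the residue [inord 1] is 0, so this case is apart. *)
have [N1|N_gt1] := leqP N 1.
  by rewrite /coprime eqn_leq gcdn_gt0 andbT (leq_trans _ N1) // dvdn_leq // dvdn_gcdl.
have: inord 1 \in D by rewrite DT in_setT.
by rewrite inE inordK // dvdn1.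
Qed.

(** * Norms of ratios *)

(** For nonzero x, multiply by x: with s = 1 + q + ... + q^(N-1) the exponents satisfy q s + 1 = s +
    q^N, and x^(q^N) = x. *)
Lemma normF_inFq (x : F) : inFq q (normF q N x).
Proof.
have [->|x_neq0] := eqVneq x 0; rewrite /inFq /normF.
  by rewrite big_ord_recl expn0 add1n expr0n /= expr0n; case: (q) q_gt1.
rewrite -exprM; apply/eqP; apply: (mulIf x_neq0); rewrite -exprSr.
have -> : ((\sum_(k < N) q ^ k) * q).+1 = ((\sum_(k < N) q ^ k) + q ^ N)%N.
  rewrite -(big_ord_recr N (fun k => q ^ k)%N) /= [RHS]big_ord_recl add1n.
  by rewrite big_distrl; congr _.+1; apply: eq_bigr => k _; rewrite /= -expnSr.
by rewrite exprD -cardF expf_card.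
Qed.

(** N(x)^(q^i) = N(x) because norms lie in F_q. *)
Lemma normF_ratio (a x : F) i : x != 0 ->
  normF q N (a * x ^+ (q ^ i) / x) = normF q N a.
Proof.
move=> x_neq0; rewrite /normF expr_div_n exprMn -exprM mulnC exprM.
by rewrite (inFq_frobenius _ (normF_inFq x)) mulfK // expf_neq0.
Qed.

End LinearizedPolynomials.

(** * Linear sets of graphs *)

Lemma LX_eq_mem (F : finFieldType) (X Y : {set F * F}) u :
    LX X = LX Y -> u \in X -> u != (0, 0) ->
  exists2 v, v \in Y :\ (0, 0) & exists l, u = (l * v.1, l * v.2).
Proof.
move=> eqL Xu u_neq0.
have /imsetP[v Yv uv] : Fspan u \in LX Y.
  by rewrite -eqL; apply: imset_f; rewrite !inE u_neq0.
exists v => //.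
have: u \in Fspan u.
  by apply/imsetP; exists 1; rewrite ?mul1r; case: (u).
by rewrite uv => /imsetP[l _ ->]; exists l.
Qed.

Definition graph (F : finFieldType) (f : F -> F) : {set F * F} :=
  [set (x, f x) | x : F].

Lemma LX_graph_ratios (F : finFieldType) (f g : F -> F) :
  LX (graph f) = LX (graph g) -> ratios f \subset ratios g.
Proof.
move=> eqL; apply/subsetP => _ /imsetP[x x_neq0 ->].
have x_gr : (x, f x) \in graph f by apply: imset_f.
have [|_ /setD1P[_ /imsetP[y _ ->]] [l /= [xE fxE]]] := LX_eq_mem eqL x_gr.
  by apply: contraNneq x_neq0 => -[->].
have ly_neq0 : l * y != 0 by rewrite -xE.
have [l_neq0 y_neq0] : l != 0 /\ y != 0.
  by apply/andP; rewrite -negb_or -mulf_eq0.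
by apply/imsetP; exists y => //; rewrite fxE xE -mulf_div divff // mul1r.
Qed.

(** Without nonzero vertical vectors the first projection is injective on W, hence bijective by
    counting. *)
Lemma Fq_subspace_graph (F : finFieldType) q (W : {set F * F}) :
    [pchar F].-nat q ->
    Fq_subspace q W -> #|W| = #|F| -> (forall y, (0, y) \in W -> y = 0) ->
  exists2 g, Fq_linear q g & W = graph g.
Proof.
move=> q_pchar [W0 WD WZ] cardW W_vert.
have Fq_N1 : inFq q (-1 : F) by rewrite /inFq exprNn_pchar // expr1n.
have W_fun u v : u \in W -> v \in W -> u.1 = v.1 -> u = v.
  case: u v => [x y] [x' y'] Wu Wv /= eq_x; rewrite -{}eq_x in Wv *.
  have := WD _ _ Wu (WZ _ _ Fq_N1 Wv); rewrite /= !mulN1r subrr => /W_vert/eqP.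
  by rewrite subr_eq0 => /eqP->.
have W_onto : fst @: W = [set: F].
  apply/eqP; rewrite eqEcard subsetT cardsT -cardW leq_eqVlt.
  by rewrite (_ : #|W| == _) //; apply/eqP/esym/card_in_imset => u v Wu Wv; exact: W_fun.
have W_ex x : exists y, (x, y) \in W.
  have: x \in fst @: W by rewrite W_onto.
  by case/imsetP=> -[x' y] Wu /= ->; exists y.
pose g x := xchoose (W_ex x).
have gW x : (x, g x) \in W by exact: (xchooseP (W_ex x)).
have gE x y : (x, y) \in W -> g x = y.
  by move=> Wxy; case: (W_fun _ _ (gW x) Wxy erefl).
exists g; first split=> [x y|c x Fq_c].
- by apply: gE; apply: (WD (x, g x) (y, g y)).
- by apply: gE; apply: (WZ c (x, g x)).
apply/setP => -[x y]; apply/idP/imsetP => [/gE<-|[x' _ ->] //]; by exists x.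
Qed.

(** * Recovering W from its linear set *)

Theorem mainTheorem16 (F : finFieldType) (p e n : nat) (i : nat) (a : F)
    (W : {set F * F}) :
  prime p -> (0 < e)%N ->
  let q := (p ^ e)%N in
  #|F| = (q ^ n)%N ->
  a != 0 -> coprime n i ->
  Fq_subspace q W -> #|W| = (q ^ n)%N ->
  LX (graphU q i a) = LX W ->
  exists (j : nat) (b : F),
    [/\ coprime n j, b != 0, normF q n b = normF q n a
      & W = graphU q j b].
Proof.
move=> p_pr e_gt0 q; case: n => [|n] cardF a_neq0 co_ni W_sub cardW eqL.
  by have := finNzRing_gt1 F; rewrite cardF.
have q_gt1 : (1 < q)%N by rewrite -(exp1n e) ltn_exp2r // prime_gt1.
have q_pchar : [pchar F].-nat q.
  have p_char : p \in [pchar F].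
    by apply: (@card_finPcharP F p (e * n.+1)) => //; rewrite cardF expnM.
  by rewrite (eq_pnat _ (pcharf_eq p_char)) pnatX pnat_id.
pose f x := a * x ^+ (q ^ i).
have f0 : f 0 = 0 by rewrite /f expr0n expn_eq0 -leqn0 leqNgt (ltnW q_gt1) mulr0.
(* L_U has no vertical point, as x = 0 also makes the second coordinate 0. *)
have W_vert y : (0, y) \in W -> y = 0.
  move=> Wy; apply/eqP/idPn => y_neq0.
  have [|v /setD1P[v_neq0 /imsetP[x _ vE]] [l /=]] := LX_eq_mem (esym eqL) Wy.
    by apply: contraNneq y_neq0 => -[->].
  rewrite vE /= => -[/esym/eqP]; rewrite mulf_eq0 => /orP[/eqP-> yE|/eqP x0 _].
    by rewrite yE mul0r eqxx in y_neq0.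
  by rewrite vE x0 -[a * _]/(f 0) f0 eqxx in v_neq0.
have [|g g_lin WE] := Fq_subspace_graph q_pchar W_sub _ W_vert.
  by rewrite cardW cardF.
have [b gE] := Fq_linear_qlinpoly q_pchar q_gt1 cardF g_lin.
have eqfg : LX (graph f) = LX (graph g) by rewrite -WE.
have eq_ratios : ratios f = ratios g.
  by apply/eqP; rewrite eqEsubset !LX_graph_ratios.
(* As a ratio of f, g(1) is nonzero, so g is not the zero map, and it has norm N(a); in the end g(1)
   is the coefficient b_k. *)
have /imsetP[x x_neq0 g1] : g 1 \in ratios f.
  rewrite eq_ratios -[g 1]divr1; apply: imset_f; exact: oner_neq0.
have b_neq0 : exists k, b k != 0.
  apply/existsP; apply: contraT => /existsPn b0.
  have: g 1 = 0 by rewrite gE /qlinpoly big1 // => k _; rewrite (eqP (negbNE (b0 k))) mul0r.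
  by move/eqP; apply: contraLR => _; rewrite g1 /f !mulf_neq0 ?invr_eq0 ?expf_neq0.
have eq_ratios' : ratios f = ratios (qlinpoly q b).
  by rewrite eq_ratios; apply: eq_imset => y; rewrite gE.
have [k [co_nk bk_neq0 b_uniq]] :=
  same_ratios_monomial q_pchar q_gt1 cardF co_ni b_neq0 eq_ratios'.
have gkE y : g y = b k * y ^+ (q ^ k).
  rewrite gE /qlinpoly (bigD1 k) //= big1 ?addr0 // => k' /b_uniq->.
  exact: mul0r.
exists k, (b k); split=> //; last first.
  by rewrite WE; apply: eq_imset => y; rewrite gkE.
by rewrite -(normF_ratio q_gt1 cardF a i x_neq0) -[a * _ / x]g1 gkE expr1n mulr1.
Qed.
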